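(* Let $G=K_{n_1,\dots,n_q}$ be the complete multipartite graph with part sizes $n_1,\dots,n_q$, and write $n=\sum_{i=1}^q n_i$. Then $$\ell(\mathcal A(G))=\sum_{1\le i<j<k\le q}n_in_jn_k .$$ Moreover, the spectral lower bound $\ell(\mathcal A(G))\ge\mathrm{spec}(G)$ is $$\ell(\mathcal A(G))\ \ge\ \mathrm{spec}(G)=\frac34\sum_{1\le i<j<k\le q}n_in_jn_k .$$
   Context: For a finite simple graph $G$ on $n$ vertices, $\mathrm{spec}(G):=\frac14\bigl(\sum_{v\in V(G)}d(v)^2-|E(G)|\lambda_n\bigr)$, where $d(v)$ is the degree of $v$ and $\lambda_n$ is the largest eigenvalue of the Laplacian (degree matrix minus adjacency matrix). Fix an orientation of the edges of $G=(V,E)$; the oriented incidence matrix $D$ is the $|V|\times|E|$ matrix with $D_{ve}=+1$ if $v$ is the head of $e$, $-1$ if $v$ is the tail of $e$, and $0$ otherwise. The antisymmetric line graph $\mathcal A(G)$ is the signed graph with vertex set $E(G)$ and signed adjacency matrix $D^{\mathsf T}D-2I$ (nonzero entries are edges, with the entry $\pm1$ as sign). Switching a signed graph at a vertex reverses the signs of all edges incident to it; changing the orientation changes $\mathcal A(G)$ only by switching. The sign of a cycle is the product of its edge signs, and a signed graph is balanced if all its cycles are positive. The frustration index $\ell(\Sigma)$ of a signed graph $\Sigma$ is the minimum number of edges whose deletion makes $\Sigma$ balanced (equivalently, the minimum number of negative edges among all switchings of $\Sigma$); it is switching invariant. *)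

(* Defs.v *)
From HB Require Import structures.
From mathcomp Require Import all_boot all_order all_algebra.
From mathcomp Require Import polyrcf.

Set Implicit Arguments.
Unset Strict Implicit.
Unset Printing Implicit Defensive.

Import Order.TTheory GRing.Theory Num.Theory.
Local Open Scope ring_scope.

Record sgraph := SGraph {
  vertex :> finType;
  adj : rel vertex;
  adj_sym : symmetric adj;
  adj_irr : irreflexive adj }.

Section Graph.
Variable G : sgraph.

Definition deg (v : G) : nat := #|[set w | adj v w]|.

Definition edges : {set {set G}} :=
  [set A | [exists u, exists v, adj u v && (A == [set u; v])]].

Lemma edgesP (A : {set G}) :
  reflect (exists u v, adj u v /\ A = [set u; v]) (A \in edges).
Proof.
rewrite inE; apply: (iffP existsP) => [[u /existsP[v /andP[uv /eqP->]]]|].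
  by exists u, v.
by move=> [u [v [uv ->]]]; exists u; apply/existsP; exists v; rewrite uv eqxx.
Qed.

Definition edge : finType := {A : {set G} | A \in edges}.

Record orientation := Orientation {
  tail : edge -> G;
  head : edge -> G;
  endpoints : forall e : edge, val e = [set tail e; head e] }.

(* The k-th row (column) of a matrix indexed by a finType is the one of its
   k-th element in the enumeration of that type. *)
Definition incidence (o : orientation) : 'M[int]_(#|G|, #|edge|) :=
  \matrix_(i, j)
    if enum_val i == head o (enum_val j) then 1
    else if enum_val i == tail o (enum_val j) then - 1 else 0.

Definition laplacian (R : pzRingType) : 'M[R]_#|G| :=
  diag_mx (\row_i (deg (enum_val i))%:R)
  - \matrix_(i, j) (adj (enum_val i) (enum_val j))%:R.

End Graph.

(* [rootsR p] is the increasing list of the roots of p in R, so this is the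
   largest eigenvalue of M in R; the default 0 is only reached if there is
   none. A real symmetric matrix has all its eigenvalues in R. *)
Definition max_eigenvalue (R : rcfType) n (M : 'M[R]_n) : R :=
  last 0 (rootsR (char_poly M)).

Definition spec (R : rcfType) (G : sgraph) : R :=
  4^-1 * (\sum_(v : G) (deg v)%:R ^+ 2
          - #|edge G|%:R * max_eigenvalue (laplacian G R)).

(* A signed graph on the vertex set 'I_n, given by its signed adjacency
   matrix. *)
Record sigraph n := SiGraph {
  sgmx : 'M[int]_n;
  sgmx_sym : sgmx^T = sgmx;
  sgmx_irr : forall i, sgmx i i = 0;
  sgmx_sign : forall i j, sgmx i j \in [:: -1; 0; 1] }.

Section SignedGraph.
Variable n : nat.
Implicit Types S : sigraph n.

Definition sgadj S : rel 'I_n := fun i j => sgmx S i j != 0.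

Definition sgedges S : {set {set 'I_n}} :=
  [set A | [exists i, exists j, sgadj S i j && (A == [set i; j])]].

Definition is_cycle S (c : seq 'I_n) : bool :=
  (2 < size c)%N && ucycleb (sgadj S) c.

Definition cycle_sign S (c : seq 'I_n) : int :=
  \prod_(i <- c) sgmx S i (next c i).

(* Cycles have no repeated vertex, hence length at most n. *)
Definition balanced S : bool :=
  [forall k : 'I_n.+1, forall c : k.-tuple 'I_n,
     is_cycle S c ==> (cycle_sign S c == 1)].

Lemma balancedP S :
  reflect (forall c, is_cycle S c -> cycle_sign S c = 1) (balanced S).
Proof.
apply: (iffP forallP) => [bal c cyc | bal k].
  have le_c : (size c < n.+1)%N.
    move: cyc => /andP[_ /andP[_ /card_uniqP <-]].
    by rewrite ltnS -[X in (_ <= X)%N](card_ord n) max_card.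
  have /forallP/(_ (in_tuple c))/implyP/(_ cyc)/eqP := bal (Ordinal le_c).
  exact.
by apply/forallP => c; apply/implyP => /bal ->.
Qed.

Definition delete_mx S (F : {set {set 'I_n}}) : 'M[int]_n :=
  \matrix_(i, j) if [set i; j] \in F then 0 else sgmx S i j.

Fact delete_sym S F : (delete_mx S F)^T = delete_mx S F.
Proof.
apply/matrixP => i j; rewrite !mxE setUC.
by rewrite -[sgmx S j i]/(sgmx S j i) -{1}(sgmx_sym S) mxE.
Qed.

Fact delete_irr S F i : delete_mx S F i i = 0.
Proof. by rewrite mxE sgmx_irr if_same. Qed.

Fact delete_sign S F i j : delete_mx S F i j \in [:: -1; 0; 1].
Proof. by rewrite mxE; case: ifP => // _; apply: sgmx_sign. Qed.

Definition delete S F : sigraph n :=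
  SiGraph (@delete_sym S F) (@delete_irr S F) (@delete_sign S F).

Definition balanced_by_deleting S (k : nat) : bool :=
  [exists F : {set {set 'I_n}},
     [&& F \subset sgedges S, #|F| == k & balanced (delete S F)]].

Fact balanced_by_deleting_ex S : exists k, balanced_by_deleting S k.
Proof.
exists #|sgedges S|; apply/existsP; exists (sgedges S).
rewrite subxx eqxx; apply/balancedP => -[|x c] // /andP[_ /andP[cyc _]].
have := next_cycle cyc (mem_head x c); move: (next _ x) => y.
rewrite /sgadj mxE; case: ifPn => [|xyE xy]; first by rewrite eqxx.
case/negP: xyE; rewrite inE; apply/existsP; exists x.
by apply/existsP; exists y; rewrite /sgadj xy eqxx.
Qed.

Definition frustration_index S : nat := ex_minn (balanced_by_deleting_ex S).

End SignedGraph.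

Section AntisymmetricLineGraph.
Variables (G : sgraph) (o : orientation G).

Definition line_mx : 'M[int]_#|edge G| :=
  (incidence o)^T *m incidence o - 2%:M.

Lemma tail_neq_head e : tail o e != head o e.
Proof.
have /edgesP[u [v [uv Auv]]] := valP e.
have neq_uv : u != v by apply: contraTneq uv => ->; rewrite adj_irr.
have : #|val e| = 2 by rewrite Auv cards2 neq_uv.
by rewrite (endpoints o) cards2; case: eqP.
Qed.

Lemma edge_eq (e f : edge G) :
  tail o e = tail o f /\ head o e = head o f \/
  tail o e = head o f /\ head o e = tail o f -> e = f.
Proof.
move=> H; apply: val_inj; rewrite !(endpoints o).
by case: H => -[-> ->] //; rewrite setUC.
Qed.

(* The two non-zero terms of the scalar product of two columns of D. *)
Lemma line_mxE i j : let e := enum_val i in let f := enum_val j in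
  line_mx i j = (head o e == head o f)%:R - (head o e == tail o f)%:R
    - (tail o e == head o f)%:R + (tail o e == tail o f)%:R
    - (i == j)%:R *+ 2.
Proof.
move=> e f; rewrite !mxE; congr (_ - _); last by case: (i == j).
pose d (g : edge G) (v : G) : int := (v == head o g)%:R - (v == tail o g)%:R.
have dE g v : (if v == head o g then 1 else if v == tail o g then -1 else 0)
    = d g v.
  rewrite /d; case: eqP => [->|_]; last by case: eqP; rewrite ?subr0 ?sub0r.
  by rewrite eq_sym (negPf (tail_neq_head g)) subr0.
under eq_bigr do rewrite !mxE !dE.
rewrite -(big_enum_val (fun v => d (enum_val i) v * d (enum_val j) v)) /=.
rewrite -/e -/f (bigD1 (head o e)) //= (bigD1 (tail o e)) ?tail_neq_head //=.
rewrite big1 ?addr0 => [|v /andP[/negPf vh /negPf vt]]; last first.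
  by rewrite /d vh vt subrr mul0r.
rewrite /d !eqxx [head o e == tail o e]eq_sym (negPf (tail_neq_head e)).
by rewrite subr0 sub0r mul1r mulN1r opprB addrA (addrAC _ (tail o e == tail o f)%:R).
Qed.

Fact line_sym : line_mx^T = line_mx.
Proof.
by rewrite /line_mx linearB /= trmx_mul trmxK tr_scalar_mx.
Qed.

Fact line_irr i : line_mx i i = 0.
Proof.
rewrite line_mxE !eqxx (negPf (tail_neq_head _)) eq_sym.
by rewrite (negPf (tail_neq_head _)) !subr0.
Qed.

Fact line_sign i j : line_mx i j \in [:: -1; 0; 1].
Proof.
have [->|neq_ij] := eqVneq i j; first by rewrite line_irr.
have neq_ef : enum_val i <> enum_val j.
  by move=> /enum_val_inj /eqP; rewrite (negPf neq_ij).
rewrite line_mxE (negPf neq_ij) mul0rn subr0.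
have /eqP := tail_neq_head (enum_val i); have /eqP := tail_neq_head (enum_val j).
move: neq_ef (@edge_eq (enum_val i) (enum_val j)).
move: (enum_val i) (enum_val j) => e f neq_ef ef tf te.
by do 4![case: eqP => ? /=] => //;
  solve [case: neq_ef; apply: ef; tauto | exfalso; congruence].
Qed.

(* The vertex i : 'I_#|edge G| stands for the edge [enum_val i] of G. *)
Definition antisym_line_graph : sigraph #|edge G| :=
  SiGraph line_sym line_irr line_sign.

End AntisymmetricLineGraph.

(* The vertex (i, a) is the a-th vertex of the i-th part. *)
Section CompleteMultipartite.
Variables (q : nat) (n : 'I_q -> nat).

Definition mp_vertex : finType := {i : 'I_q & 'I_(n i)}.

Definition mp_adj : rel mp_vertex := fun u v => tag u != tag v.

Fact mp_adj_sym : symmetric mp_adj.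
Proof. by move=> u v; rewrite /mp_adj eq_sym. Qed.

Fact mp_adj_irr : irreflexive mp_adj.
Proof. by move=> u; rewrite /mp_adj eqxx. Qed.

Definition complete_multipartite : sgraph := SGraph mp_adj_sym mp_adj_irr.

End CompleteMultipartite.

Lemma max_eigenvalue_laplacian (R : rcfType) (G : sgraph) :
  (0 < #|G|)%N ->
  eigenvalue (laplacian G R) (max_eigenvalue (laplacian G R)) /\
  forall a, eigenvalue (laplacian G R) a ->
    a <= max_eigenvalue (laplacian G R).
Proof.
move=> G_gt0; set L := laplacian G R.
have p0 : char_poly L != 0 by apply: monic_neq0; apply: char_poly_monic.
have memE a : (a \in rootsR (char_poly L)) = eigenvalue L a.
  by rewrite -roots_on_rootsR // eigenvalue_root_char !inE.
have eig0 : eigenvalue L 0.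
  apply/eigenvalueP; exists (const_mx 1); last first.
    apply/rV0Pn; exists (Ordinal G_gt0); rewrite mxE; exact: oner_neq0.
  rewrite scale0r; apply/rowP => j; rewrite !mxE.
  under eq_bigr do rewrite !mxE mul1r.
  rewrite sumrB (bigD1 j) //= eqxx big1 ?addr0; last first.
    by move=> i /negPf ->.
  apply/eqP; rewrite subr_eq0 mulr1n.
  rewrite -(big_enum_val (fun v => (adj v (enum_val j))%:R)) /= /deg.
  rewrite -natr_sum -sum1_card eqr_nat big_mkcond /=; apply/eqP.
  by rewrite [RHS]big_mkcond /=; apply: eq_bigr => v _; rewrite inE adj_sym; case: adj.
rewrite /max_eigenvalue -/L; move: memE.
have srt : sorted <%R (rootsR (char_poly L)) by apply: sorted_roots.
move: srt; case/lastP: (rootsR _) => [_ /(_ 0)|s x srt memE].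
  by rewrite eig0.
rewrite last_rcons; split; first by rewrite -memE mem_rcons mem_head.
move=> a; rewrite -memE mem_rcons inE => /orP[/eqP-> //|sa].
move: srt; rewrite -cats1 (sorted_pairwise lt_trans) pairwise_cat.
by rewrite allrel1r => /andP[/allP/(_ _ sa)/ltW].
Qed.

(* Main.v *)
Require Import Defs.
From mathcomp Require Import all_boot all_order all_algebra.
From mathcomp Require Import polyrcf.
From mathcomp Require Import zify ring lra.
Import Order.TTheory GRing.Theory Num.Theory.
Local Open Scope ring_scope.

(* Reorienting G only switches the line graph, so orient each edge from the part of
   smaller index to the part of larger index.  The negative edges of the
   antisymmetric line graph are then the pairs {uv, vw} with u, v, w in parts of
   increasing index, one for each triangle of G, and deleting them leaves only
   positive edges.  Conversely the three edges of a triangle of G always form a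
   negative triangle in the line graph, and distinct triangles of G give
   edge-disjoint ones since two incident edges span at most one triangle.

   With N vertices in all, an eigenvector of the Laplacian for an eigenvalue
   a > N would have coordinate sum zero, then sum zero on each part, then vanish;
   a vector constant on parts with coordinate sum zero has eigenvalue N.  Newton's
   identities for the part sizes turn spec(G) into 3/4 e_3. *)

(** * Frustration index: deletion sets and switching *)

Section Frustration.
Variable m : nat.
Implicit Types (S : sigraph m) (F : {set {set 'I_m}}).

Lemma deleteE S F i j :
  sgmx (delete S F) i j = if [set i; j] \in F then 0 else sgmx S i j.
Proof. exact: mxE. Qed.

Lemma frustration_index_le S F :
  F \subset sgedges S -> balanced (delete S F) ->
  (frustration_index S <= #|F|)%N.
Proof.
move=> sub bal; rewrite /frustration_index; case: ex_minnP => k _; apply.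
by apply/existsP; exists F; rewrite sub bal eqxx.
Qed.

Lemma frustration_index_attained S :
  exists F, [/\ F \subset sgedges S, balanced (delete S F)
              & #|F| = frustration_index S].
Proof.
rewrite /frustration_index; case: ex_minnP => k /existsP[F /and3P[sub /eqP sz bal]] _.
by exists F.
Qed.

Lemma map_next (T : eqType) (c : seq T) : uniq c -> map (next c) c = rot 1 c.
Proof.
case: c => // x c uc; rewrite rot1_cons.
apply: (@eq_from_nth _ x) => [|i]; rewrite size_map ?size_rcons // => lti.
rewrite (nth_map x) // next_nth mem_nth // index_uniq // nth_rcons.
move: lti; rewrite /= ltnS leq_eqVlt => /orP[/eqP->|lti].
  by rewrite nth_default // ltnn eqxx.
by rewrite lti; apply: set_nth_default.
Qed.

(** The successor map of a cycle without repetition only rotates its list of vertices, which leaves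
    a commutative product unchanged. *)
Lemma big_next (R : comPzRingType) (T : eqType) (c : seq T) (f : T -> R) :
  uniq c -> \prod_(i <- c) f (next c i) = \prod_(i <- c) f i.
Proof.
move=> uc; rewrite -(big_map (next c) xpredT f) map_next //.
by apply: perm_big; rewrite perm_rot.
Qed.

(** Each vertex of a cycle lies on two of its edges, so its factor [s i] occurs twice in the cycle
    sign and cancels; cycles themselves are the same in both graphs because [s] never vanishes. *)
Lemma balanced_switch S S' (s : 'I_m -> int) :
  (forall i, s i * s i = 1) ->
  (forall i j, sgmx S i j = s i * s j * sgmx S' i j) ->
  balanced S' -> balanced S.
Proof.
move=> ss SS' /balancedP bal; apply/balancedP => c cyc.
have adjE : sgadj S =2 sgadj S'.
  move=> i j; rewrite /sgadj SS' !mulf_eq0 -!orbA.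
  have s0 k : (s k == 0) = false.
    by apply/eqP => sk0; move: (ss k); rewrite sk0 mul0r.
  by rewrite !s0.
have uc : uniq c by case/andP: cyc => _ /andP[].
rewrite /cycle_sign; under eq_bigr do rewrite SS'.
rewrite !big_split /= big_next // -big_split /= [X in X * _]big1 ?mul1r //.
apply: bal; move: cyc; rewrite /is_cycle /ucycleb; case: c {uc} => // x p.
by rewrite /= (eq_path adjE).
Qed.

(** An optimal deletion set for [S'] also works for [S], since deletion commutes with switching. *)
Lemma frustration_index_switch_le S S' (s : 'I_m -> int) :
  (forall i, s i * s i = 1) ->
  (forall i j, sgmx S i j = s i * s j * sgmx S' i j) ->
  (frustration_index S <= frustration_index S')%N.
Proof.
move=> ss SS'; have [F [sub bal <-]] := frustration_index_attained S'.
apply: frustration_index_le.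
  apply: subset_trans sub _; apply/subsetP => A; rewrite !inE.
  move=> /existsP[i /existsP[j /andP[ij AE]]].
  apply/existsP; exists i; apply/existsP; exists j; rewrite AE andbT.
  apply: contraNneq ij => Sij; move: (SS' i j) => /(congr1 ( *%R (s i * s j))).
  by rewrite Sij mulr0 mulrA mulrACA !ss !mul1r => <-.
apply: balanced_switch bal => // i j; rewrite !deleteE.
by case: ifP; rewrite ?mulr0.
Qed.

Lemma frustration_index_switch S S' (s : 'I_m -> int) :
  (forall i, s i * s i = 1) ->
  (forall i j, sgmx S i j = s i * s j * sgmx S' i j) ->
  frustration_index S = frustration_index S'.
Proof.
move=> ss SS'; apply/eqP; rewrite eqn_leq.
rewrite (frustration_index_switch_le _ _ s) //=.
rewrite (frustration_index_switch_le _ _ s) // => i j.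
by rewrite SS' mulrA mulrACA !ss !mul1r.
Qed.

End Frustration.

Lemma set2_eq (T : finType) (a b c d : T) :
  [set a; b] = [set c; d] -> a = c /\ b = d \/ a = d /\ b = c.
Proof.
move=> E; have := (set21 a b, set22 a b, (set21 c d, set22 c d)).
rewrite E -{3 4}E => -[[/set2P[]-> /set2P[]->] [/set2P[] ? /set2P[] ?]]; subst; auto.
Qed.

Lemma frustration_index_orientation (G : sgraph) (o o' : orientation G) :
  frustration_index (antisym_line_graph o)
  = frustration_index (antisym_line_graph o').
Proof.
(* Reversing an edge negates its column of the incidence matrix, so the switching sign is -1 exactly
   at the edges on which the orientations differ. *)
pose s (i : 'I_#|edge G|) : int := if Defs.head o (enum_val i) == Defs.head o' (enum_val i) then 1 else -1.
apply: (@frustration_index_switch _ _ _ s) => [i|i j /=].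
  by rewrite /s; case: ifP.
have [<-|neq_ij] := eqVneq i j; first by rewrite !line_irr mulr0.
rewrite !line_mxE (negPf neq_ij) /s.
have E (k : 'I_#|edge G|) := set2_eq _ _ _ _ _ (etrans (esym (endpoints o (enum_val k))) (endpoints o' (enum_val k))).
have th (k : 'I_#|edge G|) := negPf (tail_neq_head o' (enum_val k)).
have ht (k : 'I_#|edge G|) := etrans (eq_sym _ _) (th k).
have [[-> ->]|[-> ->]] := E i; have [[-> ->]|[-> ->]] := E j;
  rewrite ?eqxx ?th ?ht !mul0rn; ring.
Qed.

(** * Triangles of the multipartite graph and negative pairs of edges *)

Section Triangles.
Variables (q : nat) (n : 'I_q -> nat).
Local Notation V := (mp_vertex n).
Local Notation G := (complete_multipartite n).
Implicit Types (u v w : V) (o : orientation G) (e : edge G) (t : V * V * V).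

Definition increasing o := forall e, (tag (Defs.tail o e) < tag (Defs.head o e))%N.

Lemma increasing_orientation o : exists o', increasing o'.
Proof.
pose up e := (tag (Defs.tail o e) < tag (Defs.head o e))%N.
pose lo e := if up e then Defs.tail o e else Defs.head o e.
pose hi e := if up e then Defs.head o e else Defs.tail o e.
have loE e : val e = [set lo e; hi e].
  by rewrite (endpoints o) /lo /hi; case: ifP => // _; rewrite setUC.
exists (Orientation loE) => e; rewrite /= /lo /hi; case: ifPn => //.
rewrite /up -leqNgt leq_eqVlt => /orP[|//] /eqP/val_inj thE; exfalso.
have /edgesP[u [v [uv]]] := valP e; rewrite (endpoints o) => /set2_eq.
by case=> -[hu hv]; move: uv; rewrite -hu -hv /= /mp_adj thE eqxx.
Qed.

Definition triangles : {set V * V * V} :=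
  [set t : V * V * V | (tag t.1.1 < tag t.1.2)%N && (tag t.1.2 < tag t.2)%N].

Definition support t : {set V} := [set t.1.1; t.1.2; t.2].

(** Sorting the three vertices by part index recovers the triple. *)
Lemma support_inj : {in triangles &, injective support}.
Proof.
move=> [[u v] w] [[u' v'] w']; rewrite !inE /= => /andP[uv vw] /andP[uv' vw'].
move/setP=> E.
have := (E u', E v', E w').
rewrite !inE /= !eqxx ?orbT -?orbA.
move=> [[/or3P[]/eqP ? /or3P[]/eqP ?] /or3P[]/eqP ?]; subst => //; exfalso; lia.
Qed.

(** For two edges of a triangle of G this is the vertex set of that triangle, so it compares
    line-graph edges with the supports of triangles. *)
Definition union_edges (A : {set 'I_#|edge G|}) : {set V} :=
  \bigcup_(i in A) val (enum_val i).

Lemma union_edges2 o (i j : 'I_#|edge G|) : union_edges [set i; j] =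
  [set Defs.tail o (enum_val i); Defs.head o (enum_val i)]
  :|: [set Defs.tail o (enum_val j); Defs.head o (enum_val j)].
Proof. by rewrite /union_edges bigcup_setU !big_set1 !(endpoints o). Qed.

Lemma edge_between o u v : increasing o -> (tag u < tag v)%N ->
  exists i : 'I_#|edge G|, Defs.tail o (enum_val i) = u /\ Defs.head o (enum_val i) = v.
Proof.
move=> inc uv.
have uvE : [set u; v] \in edges G.
  by apply/edgesP; exists u, v; split=> //=; rewrite /mp_adj neq_ltn uv.
pose e : edge G := Sub [set u; v] uvE; exists (enum_rank e); rewrite enum_rankK.
have := inc e; have := esym (endpoints o e); move=> /set2_eq[] [-> ->] //; lia.
Qed.

Section Increasing.
Variable o : orientation G.
Hypothesis inc : increasing o.
Local Notation tl i := (Defs.tail o (enum_val i)).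
Local Notation hd i := (Defs.head o (enum_val i)).
Local Notation S := (antisym_line_graph o).

Definition negative : {set {set 'I_#|edge G|}} :=
  [set A | [exists i, exists j, (sgmx S i j == -1) && (A == [set i; j])]].

(** Every remaining edge is positive, so all factors of a cycle sign are 1. *)
Lemma balanced_delete_negative : balanced (delete S negative).
Proof.
apply/balancedP => c /andP[_ /andP[cyc uc]]; rewrite /cycle_sign big_seq.
apply: big1 => i ic; have := next_cycle cyc ic; move: (next c i) => j.
rewrite /sgadj; have := sgmx_sign (delete S negative) i j.
rewrite deleteE; case: ifPn; first by rewrite eqxx.
rewrite !inE => ijN /or3P[]/eqP Sij; rewrite Sij // => _; case/negP: ijN.
by apply/existsP; exists i; apply/existsP; exists j; rewrite Sij !eqxx.
Qed.

(** The part indices increase strictly along the path, so the shared vertex is the only coincidence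
    of endpoints and contributes the single term -1. *)
Lemma sgmx_path (i j : 'I_#|edge G|) : hd i = tl j -> sgmx S i j = -1.
Proof.
move=> ij; rewrite /= line_mxE ij eqxx.
have jj : (tag (tl j) < tag (hd j))%N := inc _.
have ii : (tag (tl i) < tag (hd i))%N := inc _.
rewrite ij in ii.
have [ij'|_] := eqVneq i j; first by move: ii; rewrite ij' ltnn.
case: eqP => [E|_]; first by move: jj; rewrite E ltnn.
case: eqP => [E|_]; first by move: (leq_trans ii (ltnW jj)); rewrite E ltnn.
case: eqP => [E|_]; first by move: ii; rewrite E ltnn.
by [].
Qed.

Lemma sgmx_head (i j : 'I_#|edge G|) : i != j -> hd i = hd j -> sgmx S i j = 1.
Proof.
move=> neq ij; rewrite /= line_mxE ij eqxx (negPf neq).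
have th := tail_neq_head o; rewrite (eq_sym (hd j)) (negPf (th _)) -ij (negPf (th _)).
case: eqP => // E; case/eqP: neq; apply: enum_val_inj; apply: (edge_eq (o := o)); by left.
Qed.

Lemma sgmx_tail (i j : 'I_#|edge G|) : i != j -> tl i = tl j -> sgmx S i j = 1.
Proof.
move=> neq ij; rewrite /= line_mxE ij eqxx (negPf neq).
have th := tail_neq_head o; rewrite (negPf (th _)) -ij (eq_sym (hd i) (tl i)) (negPf (th _)).
case: eqP => // E; case/eqP: neq; apply: enum_val_inj; apply: (edge_eq (o := o)); by left.
Qed.

Lemma sgmx_eqN1 (i j : 'I_#|edge G|) : sgmx S i j = -1 -> hd i = tl j \/ hd j = tl i.
Proof.
move=> E; have [ij|neq] := eqVneq i j; first by move: E; rewrite ij sgmx_irr.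
move: E; rewrite /= line_mxE (negPf neq) mul0rn.
case: (hd i =P hd j) => _; case: (hd i =P tl j) => H; auto;
case: (tl i =P hd j) => H2; auto; by case: eqP.
Qed.

Lemma negative_triangle A : A \in negative -> exists t (i j : 'I_#|edge G|),
  [/\ t \in triangles, A = [set i; j],
      tl i = t.1.1 /\ hd i = t.1.2 & tl j = t.1.2 /\ hd j = t.2].
Proof.
rewrite inE => /existsP[i /existsP[j /andP[/eqP /sgmx_eqN1 ij /eqP ->]]].
wlog ij' : i j {ij} / hd i = tl j.
  by move=> H; case: ij => ij; [exact: H | rewrite setUC; exact: H].
exists (tl i, hd i, hd j), i, j; split=> //; rewrite inE /= inc /= ij'; exact: inc.
Qed.

(** The vertices of a negative pair form the support of a triangle, whose first and last edge in
    increasing order are that pair; hence [union_edges] is injective on negative pairs. *)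
Lemma card_negative_le : (#|negative| <= #|triangles|)%N.
Proof.
have uE t (i j : 'I_#|edge G|) : tl i = t.1.1 /\ hd i = t.1.2 -> tl j = t.1.2 /\ hd j = t.2 ->
    union_edges [set i; j] = support t.
  move=> [ti hi] [tj hj]; rewrite (union_edges2 o) ti hi tj hj.
  by apply/setP => x; rewrite !inE; do 3!case: (x == _).
have inj : {in negative &, injective union_edges}.
  move=> A B /negative_triangle[t [i [j [tT -> ti tj]]]].
  move=> /negative_triangle[t' [i' [j' [tT' -> ti' tj']]]].
  rewrite (uE _ _ _ ti tj) (uE _ _ _ ti' tj') => /(support_inj _ _ tT tT') tt'.
  subst t'; congr [set _; _]; apply: enum_val_inj; apply: (edge_eq (o := o)); left.
    by rewrite !(proj1 ti, proj1 ti', proj2 ti, proj2 ti').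
  by rewrite !(proj1 tj, proj1 tj', proj2 tj, proj2 tj').
rewrite -(card_in_imset inj).
apply: leq_trans (leq_imset_card support _); apply: subset_leq_card.
apply/subsetP => _ /imsetP[A /negative_triangle[t [i [j [tT -> ti tj]]]] ->].
by rewrite (uE _ _ _ ti tj); apply: imset_f.
Qed.

(** The edges uv, vw, uw form a line-graph triangle with signs -1, 1, 1. A balanced remainder cannot
    contain it, so [F] meets it, and any two of the three edges cover u, v, w. *)
Lemma balanced_delete_triangle (F : {set {set 'I_#|edge G|}}) t :
  balanced (delete S F) -> t \in triangles ->
  exists2 A, A \in F & union_edges A = support t.
Proof.
case: t => [[u v] w] /balancedP bal; rewrite inE /= => /andP[uv vw].
have [i [ti hi]] := edge_between o _ _ inc uv.
have [j [tj hj]] := edge_between o _ _ inc vw.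
have [k [tk hk]] := edge_between o _ _ inc (ltn_trans uv vw).
have neq_ij : i != j by apply/eqP => E; move: uv; rewrite -ti E tj ltnn.
have neq_jk : j != k by apply/eqP => E; move: uv; rewrite -tk -E tj ltnn.
have neq_ki : k != i by apply/eqP => E; move: vw; rewrite -hk E hi ltnn.
have [ijF|ijF] := boolP ([set i; j] \in F).
  exists [set i; j] => //; rewrite (union_edges2 o) ti hi tj hj.
  by apply/setP => x; rewrite !inE /=; do 3!case: (x == _).
have [jkF|jkF] := boolP ([set j; k] \in F).
  exists [set j; k] => //; rewrite (union_edges2 o) tj hj tk hk.
  by apply/setP => x; rewrite !inE /=; do 3!case: (x == _).
have [kiF|kiF] := boolP ([set k; i] \in F).
  exists [set k; i] => //; rewrite (union_edges2 o) tk hk ti hi.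
  by apply/setP => x; rewrite !inE /=; do 3!case: (x == _).
have ijE : sgmx (delete S F) i j = -1.
  by rewrite deleteE (negPf ijF) sgmx_path // hi.
have jkE : sgmx (delete S F) j k = 1.
  by rewrite deleteE (negPf jkF) sgmx_head // hj.
have kiE : sgmx (delete S F) k i = 1.
  by rewrite deleteE (negPf kiF) sgmx_tail // tk.
have := bal [:: i; j; k].
rewrite /is_cycle /cycle_sign /ucycleb !big_cons big_nil /= /sgadj.
rewrite ijE jkE kiE /= !inE negb_or neq_ij neq_jk (eq_sym i) neq_ki.
rewrite !eqxx (eq_sym j i) (negPf neq_ij) (eq_sym k j) (negPf neq_jk) (negPf neq_ki) ijE jkE kiE /=.
by move/(_ isT).
Qed.

Lemma frustration_index_increasing : frustration_index S = #|triangles|.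
Proof.
apply/eqP; rewrite eqn_leq; apply/andP; split.
  apply: leq_trans card_negative_le.
  apply: frustration_index_le balanced_delete_negative.
  apply/subsetP => A; rewrite !inE => /existsP[i /existsP[j /andP[/eqP ij AE]]].
  by apply/existsP; exists i; apply/existsP; exists j; rewrite AE /sgadj ij.
(* Lower bound: the sets [union_edges A] for [A] in an optimal [F] include all triangle supports,
   which are pairwise distinct. *)
have [F [_ bal <-]] := frustration_index_attained _ S.
rewrite -(card_in_imset support_inj).
apply: leq_trans (leq_imset_card union_edges _); apply: subset_leq_card.
apply/subsetP => _ /imsetP[t tT ->].
by have [A AF <-] := balanced_delete_triangle _ _ bal tT; apply: imset_f.
Qed.

End Increasing.

Lemma frustration_index_triangles o :
  frustration_index (antisym_line_graph o) = #|triangles|.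
Proof.
have [o' inc] := increasing_orientation o.
by rewrite (frustration_index_orientation _ _ o') frustration_index_increasing.
Qed.

(** * Counting triangles and edges by part sizes *)

Lemma sum_parts (M : nmodType) (P : pred 'I_q) (f : 'I_q -> M) :
  \sum_(v : V | P (tag v)) f (tag v) = \sum_(i | P i) f i *+ n i.
Proof.
rewrite (partition_big (fun v : V => tag v) P) //=; apply: eq_bigr => i Pi.
under eq_bigr => v /andP[_ /eqP ->] do [].
rewrite sumr_const; congr (_ *+ _).
rewrite -[RHS]card_ord -[RHS](card_image (f := Tagged (fun i => 'I_(n i)))); last first.
  by move=> a b /eqP; rewrite eq_Tagged => /eqP.
apply: eq_card => -[j a]; rewrite ?inE /=.
apply/andP/imageP => /= [[_ /eqP E]|[b _ /(congr1 tag)/= ->]] //.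
by subst j; exists a.
Qed.

Lemma sum_parts_nat (P : pred 'I_q) (f : 'I_q -> nat) :
  (\sum_(v : V | P (tag v)) f (tag v) = \sum_(i | P i) n i * f i)%N.
Proof.
rewrite (sum_parts nat P f); apply: eq_bigr => i _.
by rewrite mulnC; elim: (n i) => [|k IH]; rewrite ?muln0 // mulrS IH mulnS.
Qed.

Lemma card_triangles : #|triangles| =
  (\sum_(i < q) \sum_(j < q | i < j) \sum_(k < q | j < k) n i * n j * n k)%N.
Proof.
transitivity (\sum_(u : V) \sum_(v : V | tag u < tag v)
                \sum_(w : V | tag v < tag w) 1)%N.
  rewrite pair_big_dep pair_big_dep /= sum1dep_card -cardsE.
  by congr #|pred_of_set _|; apply/setP => t; rewrite !inE.
(* The inner sums depend on a vertex only through its part, so the triple sum collapses one level at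
   a time. *)
pose g (i : 'I_q) := (\sum_(w : V | i < tag w) 1)%N.
pose h (i : 'I_q) := (\sum_(v : V | i < tag v) g (tag v))%N.
rewrite (sum_parts_nat xpredT h); apply: eq_bigr => i _.
rewrite /h (sum_parts_nat (fun j => i < j)%N g) big_distrr; apply: eq_bigr => j _ /=.
rewrite /g (sum_parts_nat (fun k => j < k)%N (fun=> 1%N)) mulnA big_distrr.
by apply: eq_bigr => k _; rewrite muln1.
Qed.

Lemma card_edges o :
  #|edge G| = (\sum_(i < q) \sum_(j < q | i < j) n i * n j)%N.
Proof.
have [o' inc] := increasing_orientation o.
(* Under an increasing orientation, [ends] matches the edges with the vertex pairs of increasing
   part index. *)
pose ends (e : edge G) := (Defs.tail o' e, Defs.head o' e).
have ends_inj : injective ends.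
  by move=> e f [ht hh]; apply: (edge_eq (o := o')); left.
transitivity (\sum_(u : V) \sum_(v : V | tag u < tag v) 1)%N.
  rewrite pair_big_dep /= sum1dep_card -(card_image ends_inj).
  apply: eq_card => -[u v]; rewrite inE /=; apply/imageP/idP => [[e _ [-> ->]]|uv].
    exact: inc.
  have [i [ti hi]] := edge_between o' _ _ inc uv.
  by exists (enum_val i); rewrite // /ends ti hi.
rewrite (sum_parts_nat xpredT (fun i => \sum_(v : V | i < tag v) 1)%N).
apply: eq_bigr => i _.
rewrite (sum_parts_nat (fun j => i < j)%N (fun=> 1%N)) big_distrr.
by apply: eq_bigr => j _; rewrite muln1.
Qed.

End Triangles.

(** * Newton's identities for the second and third elementary symmetric sums *)

Section Newton.
Variable A : comPzRingType.

Lemma sum_ord_gt q (F : 'I_q.+1 -> A) (i : 'I_q) :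
  \sum_(j < q.+1 | (lift ord0 i < j)%N) F j = \sum_(j < q | (i < j)%N) F (lift ord0 j).
Proof.
rewrite big_mkcond big_ord_recl /= add0r [RHS]big_mkcond.
by apply: eq_bigr => j _.
Qed.

Lemma sum_ord_gt0 q (F : 'I_q.+1 -> A) :
  \sum_(j < q.+1 | ((@ord0 q) < j)%N) F j = \sum_(j < q) F (lift ord0 j).
Proof. by rewrite big_mkcond big_ord_recl /= add0r; apply: eq_bigr. Qed.

Lemma newton2 q (x : 'I_q -> A) :
  2%:R * (\sum_(i < q) \sum_(j < q | (i < j)%N) x i * x j)
  = (\sum_i x i) ^+ 2 - \sum_i x i ^+ 2.
Proof.
elim: q x => [|q IH] x; first by rewrite !big_ord0; ring.
rewrite !big_ord_recl sum_ord_gt0 mulrDr.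
under [\sum_(i < q) \sum_(j < q.+1 | _) _]eq_bigr do rewrite sum_ord_gt.
by rewrite (IH (fun i => x (lift ord0 i))) -mulr_sumr; ring.
Qed.

Lemma newton3 q (x : 'I_q -> A) :
  6%:R * (\sum_(i < q) \sum_(j < q | (i < j)%N) \sum_(k < q | (j < k)%N) x i * x j * x k)
  = (\sum_i x i) ^+ 3 - 3%:R * (\sum_i x i) * (\sum_i x i ^+ 2)
    + 2%:R * \sum_i x i ^+ 3.
Proof.
elim: q x => [|q IH] x; first by rewrite !big_ord0; ring.
rewrite !big_ord_recl sum_ord_gt0 mulrDr; set y := fun i => x (lift ord0 i).
(* Splitting off the first variable: the products containing it sum to [x ord0] times the second
   elementary sum of the others, which [newton2] then evaluates. *)
have -> : \sum_(i < q) \sum_(k < q.+1 | (lift ord0 i < k)%N)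
    x ord0 * x (lift ord0 i) * x k
  = x ord0 * \sum_(i < q) \sum_(k < q | (i < k)%N) y i * y k.
  rewrite mulr_sumr; apply: eq_bigr => i _; rewrite sum_ord_gt mulr_sumr.
  by apply: eq_bigr => k _; rewrite mulrA.
under [X in _ + 6%:R * X]eq_bigr => i _.
  rewrite sum_ord_gt; under eq_bigr do rewrite sum_ord_gt; over.
rewrite (IH y); have := newton2 _ y; set e2 := \sum_i _ => n2.
have -> : 6%:R * (x ord0 * e2) = 3%:R * x ord0 * (2%:R * e2) by ring.
by rewrite n2; ring.
Qed.

End Newton.

(** * Largest Laplacian eigenvalue and the spectral bound *)

Section Spectrum.
Variables (R : rcfType) (q : nat) (n : 'I_q -> nat).
Local Notation V := (mp_vertex n).
Local Notation G := (complete_multipartite n).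
Local Notation L := (laplacian G R).
Let N : R := \sum_i (n i)%:R.

Lemma card_part i : #|[pred v : V | tag v == i]| = n i.
Proof.
rewrite -sum1_card (sum_parts_nat _ _ (pred1 i) (fun=> 1%N)).
by rewrite big_pred1_eq muln1.
Qed.

Lemma degE (v : G) : (deg v)%:R = N - (n (tag v))%:R :> R.
Proof.
apply/eqP; rewrite eq_sym subr_eq -natrD; apply/eqP.
have -> : N = #|V|%:R.
  by rewrite /N -natr_sum -sum1_card (sum_parts_nat _ _ xpredT (fun=> 1%N));
    congr (_%:R); apply: eq_bigr => i _; rewrite muln1.
rewrite -(cardC [pred w : V | tag w == tag v]) card_part addnC.
congr (_ + _)%:R; apply: eq_card => w; rewrite !inE /= /mp_adj eq_sym //.
Qed.

(** The neighbours of [v] are exactly the vertices outside its part, so their sum is the total minus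
    the sum over that part. *)
Lemma mul_laplacian (x : 'rV[R]_#|G|) (v : G) :
  (x *m L) 0 (enum_rank v) = (N - (n (tag v))%:R) * x 0 (enum_rank v)
  - (\sum_w x 0 (enum_rank w) - \sum_(w : V | tag w == tag v) x 0 (enum_rank w)).
Proof.
rewrite mulmxBr mxE mul_mx_diag !mxE enum_rankK degE mulrC; congr (_ - _).
under eq_bigr do rewrite mxE enum_rankK.
rewrite (reindex (@enum_rank G)) /=; last exact/onW_bij/enum_rank_bij.
rewrite (bigID (fun w : V => tag w == tag v)) /=.
rewrite [X in _ = X - _](bigID (fun w : V => tag w == tag v)) /=.
rewrite addrAC subrr add0r big1 ?add0r => [|w /eqP wv]; last first.
  by rewrite enum_rankK /mp_adj wv eqxx mulr0.
by apply: eq_bigr => w wv; rewrite enum_rankK /= /mp_adj wv mulr1.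
Qed.

Lemma eigenvalue_laplacian_le a : eigenvalue L a -> a <= N.
Proof.
move=> /eigenvalueP[x xL]; apply: contraR; rewrite -ltNge => ltNa.
pose y (v : V) := x 0 (enum_rank v).
pose P i := \sum_(w : V | tag w == i) y w.
have n_ge0 i : 0 <= (n i)%:R :> R by exact: ler0n.
have N_ge0 : 0 <= N by apply: sumr_ge0 => i _; exact: n_ge0.
have yE v : a * y v = (N - (n (tag v))%:R) * y v - (\sum_w y w - P (tag v)).
  by rewrite -mul_laplacian xL mxE.
(* The eigenvector equation summed over part [i]; the terms in [n i * P i] cancel. *)
have partE i : a * P i = N * P i - (n i)%:R * \sum_w y w.
  rewrite /P mulr_sumr.
  under eq_bigr => w /eqP wi do rewrite yE wi.
  rewrite sumrB -mulr_sumr sumr_const [#|_|](card_part i).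
  rewrite -/(P i) -[(_ - P i) *+ _]mulr_natl; ring.
have sumP : \sum_i P i = \sum_w y w.
  by rewrite [RHS](partition_big (fun v : V => tag v) xpredT).
(* Summing [partE] over all parts gives N times the total minus N times the total, and [a] is
   nonzero because it exceeds N. *)
have S0 : \sum_w y w = 0.
  have : a * \sum_w y w = 0.
    rewrite -{1}sumP mulr_sumr; under eq_bigr do rewrite partE.
    by rewrite sumrB -mulr_sumr -mulr_suml sumP subrr.
  by move/eqP; rewrite mulf_eq0 => /orP[/eqP|/eqP //]; lra.
have P0 i : P i = 0.
  have := partE i; rewrite S0 mulr0 subr0 => /eqP.
  rewrite -subr_eq0 -mulrBl mulf_eq0 => /orP[/eqP|/eqP //]; lra.
apply/eqP/rowP => k; rewrite mxE -(enum_valK k) -/(y _).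
have := yE (enum_val k); rewrite S0 P0 subrr subr0 => /eqP.
rewrite -subr_eq0 -mulrBl mulf_eq0 => /orP[/eqP|/eqP //].
have := n_ge0 (tag (enum_val k)); lra.
Qed.

Lemma eigenvalue_laplacian_card (u v : V) : tag u != tag v -> eigenvalue L N.
Proof.
move=> uv.
(* With k the size of the part of [u], the value is N - k on that part and -k on the N - k other
   vertices, so the coordinates sum to zero. *)
pose x : 'rV[R]_#|G| := \row_k (N * (tag (enum_val k) == tag u)%:R - (n (tag u))%:R).
have xE (w : V) : x 0 (enum_rank w) = N * (tag w == tag u)%:R - (n (tag u))%:R.
  by rewrite mxE enum_rankK.
have sumx : \sum_w x 0 (enum_rank w) = 0.
  under eq_bigr do rewrite xE.
  rewrite (sum_parts _ _ R xpredT (fun i => N * (i == tag u)%:R - (n (tag u))%:R)).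
  under eq_bigr do rewrite mulrnBl.
  rewrite sumrB; apply/eqP; rewrite subr_eq0; apply/eqP.
  rewrite (bigD1 (tag u)) //= eqxx mulr1 big1 ?addr0 => [|i /negPf ->].
    by rewrite -[N *+ _]mulr_natl /N mulr_sumr; apply: eq_bigr => i _; rewrite mulr_natr.
  by rewrite mulr0 mul0rn.
apply/eigenvalueP; exists x.
  apply/rowP => k; rewrite -(enum_valK k) mul_laplacian sumx.
  under eq_bigr => w /eqP wk do rewrite xE wk -xE.
  rewrite sumr_const (card_part (tag (enum_val k))) -[x _ _ *+ n _]mulr_natl [RHS]mxE; ring.
have nu : (0 < n (tag u))%N by rewrite (leq_trans _ (ltn_ord (tagged u))).
apply/rV0Pn; exists (enum_rank v); rewrite xE (eq_sym (tag v)) (negPf uv) mulr0 sub0r.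
by rewrite oppr_eq0 pnatr_eq0 -lt0n.
Qed.

(** The edge count stays as a factor because an edgeless graph has largest eigenvalue 0 rather than
    N; both sides then vanish. An edge supplies the two distinct parts needed for the eigenvalue
    N. *)
Lemma card_edge_max_eigenvalue :
  #|edge G|%:R * max_eigenvalue L = #|edge G|%:R * N.
Proof.
have [->|] := posnP #|edge G|; first by rewrite !mul0r.
case/card_gt0P=> e _; congr (_ * _).
have /edgesP[u [v [uv _]]] := valP e.
have G0 : (0 < #|G|)%N by apply/card_gt0P; exists u.
have [eig le_max] := max_eigenvalue_laplacian R G0.
apply/eqP; rewrite eq_le eigenvalue_laplacian_le //=.
exact/le_max/eigenvalue_laplacian_card/uv.
Qed.

Lemma spec_multipartite (o : orientation G) : spec R G = 3 / 4 *
  \sum_(i < q) \sum_(j < q | (i < j)%N) \sum_(k < q | (j < k)%N)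
     (n i)%:R * (n j)%:R * (n k)%:R.
Proof.
rewrite /spec card_edge_max_eigenvalue; under eq_bigr do rewrite degE.
rewrite (sum_parts _ _ R xpredT (fun i => (N - (n i)%:R) ^+ 2)).
rewrite (card_edges _ _ o) natr_sum.
under [X in _ - X * _]eq_bigr => i _.
  rewrite natr_sum; under eq_bigr do rewrite natrM; over.
pose x (i : 'I_q) : R := (n i)%:R.
have := newton2 _ _ x; have := newton3 _ _ x; rewrite -/N.
(* The multiplicity [n i] raises each power of [x i] by one, so the sum of squared degrees involves
   power sums up to the third. *)
have -> (a : R) : \sum_i (a - x i) ^+ 2 *+ n i
    = a ^+ 2 * (\sum_i x i) - 2 * a * (\sum_i x i ^+ 2) + \sum_i x i ^+ 3.
  rewrite !mulr_sumr -sumrB -big_split /=.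
  by apply: eq_bigr => i _; rewrite -[LHS]mulr_natr -/(x i); ring.
have -> : \sum_i x i = N by [].
set e2 := \sum_i \sum_(j | _) x i * x j; set p2 := \sum_i x i ^+ 2.
move=> n3 n2.
(* [newton2] times N expresses the product of the edge count and N in power sums; what remains is
   linear in the monomials of [newton3]. *)
have n2N : 2 * e2 * N = N ^+ 3 - p2 * N by rewrite n2; ring.
lra.
Qed.

End Spectrum.

Theorem proposition11 (R : rcfType) (q : nat) (n : 'I_q -> nat)
    (o : orientation (complete_multipartite n)) :
  let G := complete_multipartite n in
  let ell := frustration_index (antisym_line_graph o) in
  let t := (\sum_(i < q) \sum_(j < q | i < j) \sum_(k < q | j < k)
              n i * n j * n k)%N in
  [/\ ell = t,
      spec R G <= ell%:R
    & spec R G = 3 / 4 * t%:R].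
Proof.
move=> G ell t.
have ellE : ell = t by rewrite /ell frustration_index_triangles card_triangles.
have specE : spec R G = 3 / 4 * t%:R.
  rewrite (spec_multipartite _ _ _ o) /t natr_sum; congr (_ * _).
  apply: eq_bigr => i _; rewrite natr_sum; apply: eq_bigr => j _.
  by rewrite natr_sum; apply: eq_bigr => k _; rewrite !natrM.
split=> //; rewrite specE ellE.
have : 0 <= t%:R :> R by exact: ler0n.
lra.
Qed.
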